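(* Let $(T_0,s_0)$, the past input $q_{\rm c}|_{(-D,0)}$ and the setpoint $s_{\rm r}$ satisfy Assumptions A1, A2 and A3 of the context, let $c>0$, and consider the closed-loop system consisting of $$T_t(x,t)=\alpha T_{xx}(x,t),\ 0\le x\le s(t),\qquad -kT_x(0,t)=q_{\rm c}(t-D),\qquad T(s(t),t)=T_{\rm m},\qquad \dot s(t)=-\beta T_x(s(t),t),$$ with $T(x,0)=T_0(x)$, $s(0)=s_0$, and the delay compensated control law $$q_{\rm c}(t)=-c\left(\int_{t-D}^{t}q_{\rm c}(\theta)\,d\theta+\frac{k}{\alpha}\int_0^{s(t)}(T(x,t)-T_{\rm m})\,dx+\frac{k}{\beta}(s(t)-s_{\rm r})\right),\qquad t\ge 0.$$ Define, along the solution $(T,s)$, the nominal (delay-free) control law $$\bar q_{\rm c}(t)=-c\left(\frac{k}{\alpha}\int_0^{s(t)}(T(x,t)-T_{\rm m})\,dx+\frac{k}{\beta}(s(t)-s_{\rm r})\right).$$ Then the delay compensated control is the prediction of the nominal control law over the delay interval, i.e. $$q_{\rm c}(t)=\bar q_{\rm c}(t+D)\qquad\text{for all }t\ge 0 .$$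
   Context: Constants: $\alpha=\frac{k}{\rho C_p}>0$ and $\beta=\frac{k}{\rho\,\Delta H^*}>0$, where $\rho,C_p,k,\Delta H^*>0$ are physical parameters; $T_{\rm m}$ is the (constant) melting temperature; $D>0$ is the input delay. $T(x,t)$ is the liquid temperature on $[0,s(t)]$, $s(t)$ is the liquid-solid interface position, $q_{\rm c}(t)$ is the manipulated boundary heat flux. The values $q_{\rm c}(t)$ for $-D<t<0$ are given data (the past input). Assumption A1: $s_0>0$ and there is $H>0$ such that $T_{\rm m}\le T_0(x)\le T_{\rm m}+H(s_0-x)$ for all $x\in(0,s_0)$. Assumption A2: $q_{\rm c}(t)\ge 0$ for all $-D<t<0$. Assumption A3: $s_{\rm r}>s_0+\beta\left(\int_{-D}^{0}\frac{q_{\rm c}(t)}{k}\,dt+\frac1\alpha\int_0^{s_0}(T_0(x)-T_{\rm m})\,dx\right)$. *)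

(* Defs.v *)
(* One-phase Stefan problem with delayed boundary flux, over the reals of the
   standard library, with Coquelicot for limits, derivatives and integrals. *)
From Stdlib Require Import Reals List.
From Coquelicot Require Import Coquelicot.
Open Scope R_scope.

(* [l] is the derivative of [f] at [x] relative to [A]: the ordinary derivative
   when [x] is interior to [A], a one-sided one at an endpoint of an interval. *)
Definition is_derive_within (A : R -> Prop) (f : R -> R) (x l : R) : Prop :=
  filterlim (fun y => (f y - f x) / (y - x)) (within A (locally' x)) (locally l).

(* Finitely many exceptional points; integrability, hence boundedness, of the
   input is part of [closed_loop_solution]. *)
Definition piecewise_continuous (q : R -> R) (a b : R) : Prop :=
  exists jumps : list R,
    forall t, a < t < b -> ~ In t jumps -> continuous q t.

(* Pairs [(x, t)]; the values of [T] and its derivatives outside these sets play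
   no role. *)
Definition liquid_closed (s : R -> R) (p : R * R) : Prop :=
  0 <= snd p /\ 0 <= fst p <= s (snd p).

Definition liquid_open (s : R -> R) (p : R * R) : Prop :=
  0 < snd p /\ 0 < fst p < s (snd p).

(* Where [T_x] is required to exist and be continuous.  The boundary points
   [(0, t)] such that [q] jumps at [t - D] must be left out: the heat flux through
   [x = 0] jumps with the input there.  In general this happens at [t = D] even
   if the past input is continuous, since the feedback is switched on at time 0. *)
Definition flux_domain (D : R) (s q : R -> R) (p : R * R) : Prop :=
  0 < snd p /\ 0 <= fst p <= s (snd p) /\
  (fst p = 0 -> continuous q (snd p - D)).

Definition uncurry2 (f : R -> R -> R) (p : R * R) : R := f (fst p) (snd p).

Definition energy_error (k alpha beta Tm sr : R) (T : R -> R -> R) (s : R -> R)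
    (t : R) : R :=
  k / alpha * RInt (fun x => T x t - Tm) 0 (s t) + k / beta * (s t - sr).

Definition nominal_control (c k alpha beta Tm sr : R) (T : R -> R -> R)
    (s : R -> R) (t : R) : R :=
  - c * energy_error k alpha beta Tm sr T s t.

Definition delay_compensated_control (c k alpha beta Tm sr D : R)
    (T : R -> R -> R) (s q : R -> R) (t : R) : R :=
  - c * (RInt q (t - D) t + energy_error k alpha beta Tm sr T s t).

(* Classical solutions.  [Tx], [Txx], [Tt] are the partial derivatives of [T].
   The heat equation is imposed in the open liquid region only, where both sides
   are ordinary derivatives; [T] is continuous up to the parabolic boundary. *)
Record stefan_solution (k alpha beta Tm D : R) (T0 : R -> R) (s0 : R)
    (T Tx Txx Tt : R -> R -> R) (s q : R -> R) : Prop := {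
  interface_pos : forall t, 0 <= t -> 0 < s t;
  interface_cont : continuous_on (fun t => 0 <= t) s;
  temp_cont : continuous_on (liquid_closed s) (uncurry2 T);
  temp_dx : forall x t, flux_domain D s q (x, t) ->
    is_derive_within (fun y => 0 <= y <= s t) (fun y => T y t) x (Tx x t);
  temp_dx_cont : continuous_on (flux_domain D s q) (uncurry2 Tx);
  temp_dxx : forall x t, liquid_open s (x, t) ->
    is_derive (fun y => Tx y t) x (Txx x t);
  temp_dxx_cont : continuous_on (liquid_open s) (uncurry2 Txx);
  temp_dt : forall x t, liquid_open s (x, t) ->
    is_derive (fun tau => T x tau) t (Tt x t);
  temp_dt_cont : continuous_on (liquid_open s) (uncurry2 Tt);
  heat_equation : forall x t, liquid_open s (x, t) -> Tt x t = alpha * Txx x t;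
  boundary_flux : forall t, 0 < t -> continuous q (t - D) ->
    - k * Tx 0 t = q (t - D);
  melting_temp : forall t, 0 < t -> T (s t) t = Tm;
  interface_motion : forall t, 0 < t -> is_derive s t (- beta * Tx (s t) t);
  initial_temp : forall x, 0 <= x <= s0 -> T x 0 = T0 x;
  initial_interface : s 0 = s0
}.

(* [q] stands for the input on [(-D, +oo)]: the given past input before time 0,
   the feedback from time 0 on. *)
Record closed_loop_solution (c k alpha beta Tm D sr : R) (T0 : R -> R) (s0 : R)
    (T Tx Txx Tt : R -> R -> R) (s q : R -> R) : Prop := {
  plant : stefan_solution k alpha beta Tm D T0 s0 T Tx Txx Tt s q;
  input_integrable : forall t, 0 <= t -> ex_RInt q (- D) t;
  feedback : forall t, 0 <= t ->
    q t = delay_compensated_control c k alpha beta Tm sr D T s q t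
}.

Definition initial_data_assumption (Tm : R) (T0 : R -> R) (s0 : R) : Prop :=
  0 < s0 /\
  exists H : R, 0 < H /\
    forall x, 0 < x < s0 -> Tm <= T0 x <= Tm + H * (s0 - x).

Definition past_input_assumption (D : R) (q : R -> R) : Prop :=
  forall t, - D < t < 0 -> 0 <= q t.

Definition setpoint_assumption (k alpha beta Tm D : R) (T0 : R -> R) (s0 : R)
    (q : R -> R) (sr : R) : Prop :=
  sr > s0 + beta * (RInt (fun t => q t / k) (- D) 0
                    + 1 / alpha * RInt (fun x => T0 x - Tm) 0 s0).

(* Main.v *)
(* Heat balance: the energy error [E] satisfies [E'(t) = q (t - D)] wherever
   [q] is continuous at [t - D].  As [Txx] need not be integrable up to the
   boundary, this is shown for the energy stored in [[eps, s t - eps]], whose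
   derivative comes from the Leibniz rule and tends to [q (t - D)] locally
   uniformly by continuity of [Tx] and [T]; the mean value theorem then passes
   the estimate to the limit [eps -> 0].  The feedback law makes [q] continuous
   on positive times, so [E v - \int_{-D}^{v-D} q] is continuous on [[0, +oo)]
   with zero derivative off a finite set, hence constant; comparing its values at
   [t] and [t + D] gives the claim. *)
Require Import Defs.
From Stdlib Require Import Reals List Lra.
From Coquelicot Require Import Coquelicot.
Open Scope R_scope.

(** * Continuity of clamps and of parameter integrals; functions with almost everywhere zero
    derivative off a finite set *)

Lemma continuous_Rmax_l (a x : R) : continuous (Rmax a) x.
Proof.
apply continuous_ext with (fun y : R => (a + y + Rabs (a - y)) / 2).
- intros y; unfold Rmax, Rabs.
  destruct (Rle_dec a y), (Rcase_abs (a - y)); lra.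
- apply (continuous_mult (fun y : R => a + y + Rabs (a - y))).
  + apply (continuous_plus (fun y : R => a + y)).
    * apply (continuous_plus (fun _ : R => a)).
      apply continuous_const. apply continuous_id.
    * apply (continuous_Rabs_comp (fun y : R => a - y)).
      apply (continuous_minus (fun _ : R => a)).
      apply continuous_const. apply continuous_id.
  + apply continuous_const.
Qed.

Lemma continuous_Rmin_l (a x : R) : continuous (Rmin a) x.
Proof.
apply continuous_ext with (fun y : R => opp (Rmax (- a) (opp y))).
- intros y; rewrite <- (Ropp_involutive (Rmin a y)), Ropp_Rmin; reflexivity.
- apply (continuous_opp (fun y : R => Rmax (- a) (opp y))).
  apply (continuous_comp (fun y : R => opp y) (Rmax (- a))).
  + apply (continuous_opp (fun y : R => y)), continuous_id.
  + apply continuous_Rmax_l.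
Qed.

(** As [g] never leaves [A], the restriction to [A] disappears after composition. With clamps as
    [g], continuity relative to a closed set becomes continuity on the whole space. *)
Lemma continuous_on_comp {U V W : UniformSpace} (A : V -> Prop) (f : V -> W)
    (g : U -> V) (x : U) :
  continuous_on A f -> (forall y, A (g y)) -> continuous g x ->
  continuous (fun y => f (g y)) x.
Proof.
intros Hf HA Hg P HP.
generalize (Hg _ (Hf _ (HA x) P HP)); unfold filtermap.
apply filter_imp; auto.
Qed.

Lemma continuous_RInt_param (f : R -> R -> R) (a b : R) :
  a <= b -> (forall x y, continuity_2d_pt f x y) ->
  forall y, continuous (fun y => RInt (fun x => f x y) a b) y.
Proof.
intros Hab Hf y.
assert (Hi : forall v, ex_RInt (fun x => f x v) a b).
{ intros v; apply (ex_RInt_continuous (V := R_CompleteNormedModule)).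
  intros x _; apply (continuous_comp_2 (fun x : R => x) (fun _ : R => v) f).
  - apply continuous_id.
  - apply continuous_const.
  - apply continuity_2d_pt_filterlim, Hf. }
apply continuity_pt_filterlim, continuity_pt_locally; intros eps.
(* The [+ 1] covers the degenerate case [a = b] and makes the final bound strict. *)
assert (He : 0 < eps / (b - a + 1)).
{ apply Rdiv_lt_0_compat; [apply cond_pos | lra]. }
destruct (uniform_continuity_2d_1d f a b y (fun x _ => Hf x y)
            (mkposreal _ He)) as [d Hd].
exists d; intros v Hv.
change (Rabs (v - y) < d) in Hv.
replace (RInt (fun x => f x v) a b - RInt (fun x => f x y) a b)
  with (RInt (fun x => minus (f x v) (f x y)) a b)
  by (apply (RInt_minus (V := R_CompleteNormedModule)); apply Hi).
apply Rle_lt_trans with ((b - a) * (eps / (b - a + 1))).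
- apply abs_RInt_le_const; [exact Hab | |].
  + apply (ex_RInt_minus (V := R_CompleteNormedModule)); apply Hi.
  + intros x Hx; left.
    apply Rabs_def2 in Hv.
    assert (Hd0 := cond_pos d).
    apply (Hd x y x v); try lra.
    rewrite Rminus_diag, Rabs_R0; exact Hd0.
- apply Rlt_le_trans with ((b - a + 1) * (eps / (b - a + 1))).
  + apply Rmult_lt_compat_r; [exact He | lra].
  + right; field; lra.
Qed.

(** Induction on the exceptional points: one inside the interval splits it in two, and continuity
    there glues the halves; without exceptional points this is the mean value theorem. *)
Lemma derive_zero_off_finite_eq (L : list R) :
  forall (G : R -> R) (a b : R), a <= b ->
  (forall t, a <= t <= b -> continuous G t) ->
  (forall t, a < t < b -> ~ In t L -> is_derive G t 0) ->
  G b = G a.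
Proof.
induction L as [|p L IH]; intros G a b Hab Hc Hd.
- destruct (MVT_gen G a b (fun _ => 0)) as [x [_ Hx]].
  + rewrite Rmin_left, Rmax_right by exact Hab.
    intros x Hx; apply Hd; [exact Hx | intros []].
  + rewrite Rmin_left, Rmax_right by exact Hab.
    intros x Hx; apply continuity_pt_filterlim, Hc, Hx.
  + lra.
- destruct (Rlt_dec a p) as [Hp|Hp]; [destruct (Rlt_dec p b) as [Hq|Hq] |].
  + transitivity (G p).
    * apply IH; [lra | intros t Ht; apply Hc; lra |].
      intros t Ht Hn; apply Hd; [lra |]. intros [E|E]; [lra | tauto].
    * apply IH; [lra | intros t Ht; apply Hc; lra |].
      intros t Ht Hn; apply Hd; [lra |]. intros [E|E]; [lra | tauto].
  + apply IH; [exact Hab | exact Hc |].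
    intros t Ht Hn; apply Hd; [lra |]. intros [E|E]; [lra | tauto].
  + apply IH; [exact Hab | exact Hc |].
    intros t Ht Hn; apply Hd; [lra |]. intros [E|E]; [lra | tauto].
Qed.

Lemma continuous_on_near (A : R * R -> Prop) (f : R -> R -> R) (x t : R)
    (eta : posreal) :
  continuous_on A (uncurry2 f) -> A (x, t) ->
  exists d : posreal, forall x' t', A (x', t') ->
    Rabs (x' - x) < d -> Rabs (t' - t) < d -> Rabs (f x' t' - f x t) < eta.
Proof.
intros Hf Hx.
destruct (Hf (x, t) Hx (ball (f x t) eta) (locally_ball (f x t) eta)) as [d Hd].
exists d; intros x' t' HA Hx' Ht'.
apply (Hd (x', t')); [split; assumption | exact HA].
Qed.

(** * Regularity in the open liquid region and the truncated energy balance *)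

Section Plant.
Context {k alpha beta Tm D : R} {T0 : R -> R} {s0 : R}
  {T Tx Txx Tt : R -> R -> R} {s q : R -> R}
  (S : stefan_solution k alpha beta Tm D T0 s0 T Tx Txx Tt s q).

Lemma interface_continuous (t : R) :
  0 < t -> continuous s t.
Proof.
intros Ht; apply (ex_derive_continuous s).
eexists; exact (interface_motion _ _ _ _ _ _ _ _ _ _ _ _ _ S t Ht).
Qed.

Lemma liquid_open_locally (x t : R) :
  liquid_open s (x, t) -> locally_2d (fun v u => liquid_open s (u, v)) t x.
Proof.
intros [Ht Hx]; cbn in Ht, Hx.
(* Half the distance to the boundary: the point and the interface may each move by this much without
   meeting. *)
assert (He : 0 < Rmin x (s t - x) / 2).
{ assert (0 < Rmin x (s t - x)) by (apply Rmin_glb_lt; lra). lra. }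
destruct (proj1 (continuity_pt_locally s t)
  (proj2 (continuity_pt_filterlim s t) (interface_continuous t Ht))
  (mkposreal _ He)) as [d Hd].
simpl in Hd.
assert (H1 := Rmin_l x (s t - x)); assert (H2 := Rmin_r x (s t - x)).
set (e := Rmin x (s t - x) / 2) in *.
assert (Hm : 0 < Rmin e (Rmin d t)).
{ apply Rmin_glb_lt; [exact He | apply Rmin_glb_lt; [apply cond_pos | exact Ht]]. }
exists (mkposreal _ Hm); simpl; intros v u Hv Hu.
assert (H3 := Rmin_l e (Rmin d t)); assert (H4 := Rmin_r e (Rmin d t)).
assert (H5 := Rmin_l d t); assert (H6 := Rmin_r d t).
assert (Hs : Rabs (s v - s t) < e).
{ apply Hd; change (Rabs (v - t) < d); lra. }
apply Rabs_def2 in Hv; apply Rabs_def2 in Hu; apply Rabs_def2 in Hs.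
unfold e in *; split; cbn; lra.
Qed.

(** The region is open, so relative continuity is ordinary continuity. Time comes first, as the
    parameter does in the Leibniz rule below. *)
Lemma continuity_2d_liquid_open (f : R -> R -> R) (x t : R) :
  continuous_on (liquid_open s) (uncurry2 f) -> liquid_open s (x, t) ->
  continuity_2d_pt (fun v u => f u v) t x.
Proof.
intros Hf Hx; apply continuity_2d_pt_filterlim.
destruct (liquid_open_locally x t Hx) as [d Hd].
apply (continuous_comp_2 (fun p : R * R => snd p) (fun p : R * R => fst p) f).
- apply continuous_snd.
- apply continuous_fst.
- refine (continuous_continuous_on (liquid_open s) (uncurry2 f) (x, t) _ Hf).
  exists d; intros [u v] [Hu Hv]; apply Hd; assumption.
Qed.

Lemma continuous_liquid_open_x (f : R -> R -> R) (x t : R) :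
  continuous_on (liquid_open s) (uncurry2 f) -> liquid_open s (x, t) ->
  continuous (fun y => f y t) x.
Proof.
intros Hf Hx.
apply (continuous_comp_2 (fun _ : R => t) (fun y : R => y) (fun v u => f u v)).
- apply continuous_const.
- apply continuous_id.
- apply (continuity_2d_pt_filterlim (fun v u => f u v)).
  exact (continuity_2d_liquid_open f x t Hf Hx).
Qed.

Lemma temp_cont_open :
  continuous_on (liquid_open s) (uncurry2 T).
Proof.
apply (continuous_on_subset (liquid_closed s)).
- intros [x t] [Ht Hx]; cbn in *; split; cbn; lra.
- exact (temp_cont _ _ _ _ _ _ _ _ _ _ _ _ _ S).
Qed.

Lemma is_derive_temp_sub (x t : R) :
  liquid_open s (x, t) -> is_derive (fun tau => T x tau - Tm) t (Tt x t).
Proof.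
intros H.
replace (Tt x t) with (minus (Tt x t) 0) by apply Rminus_0_r.
apply (is_derive_minus (fun tau => T x tau) (fun _ => Tm)).
- exact (temp_dt _ _ _ _ _ _ _ _ _ _ _ _ _ S x t H).
- apply (is_derive_const (V := R_NormedModule)).
Qed.

(** The flux difference is the integral of [Tt = alpha * Txx]; the last term comes from the upper
    endpoint, which moves with the velocity of the interface. *)
Lemma truncated_energy_derive (eps t : R) :
  0 < t -> 0 < eps -> 2 * eps < s t ->
  is_derive (fun tau => RInt (fun x => T x tau - Tm) eps (s tau - eps)) t
    (alpha * (Tx (s t - eps) t - Tx eps t)
     + (T (s t - eps) t - Tm) * (- beta * Tx (s t) t)).
Proof.
intros Ht He Hs.
(* The Leibniz rule needs neighbourhoods of both endpoints, so the segment is widened by [eps / 2];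
   the radius [eps / 4] used later stays within this margin. *)
assert (Hopen : locally t (fun t' => forall x,
          eps / 2 <= x <= s t - eps / 2 -> liquid_open s (x, t'))).
{ assert (He4 : 0 < Rmin (eps / 2) t) by (apply Rmin_glb_lt; lra).
  destruct (proj1 (continuity_pt_locally s t)
    (proj2 (continuity_pt_filterlim s t) (interface_continuous t Ht))
    (mkposreal _ He4)) as [d Hd].
  assert (Hm : 0 < Rmin d t) by (apply Rmin_glb_lt; [apply cond_pos | lra]).
  exists (mkposreal _ Hm); intros t' Ht' x Hx.
  change (Rabs (t' - t) < Rmin d t) in Ht'.
  assert (H1 := Rmin_l d t); assert (H2 := Rmin_r d t).
  assert (H3 := Rmin_l (eps / 2) t).
  specialize (Hd t'); simpl in Hd.
  assert (Hs' : Rabs (s t' - s t) < Rmin (eps / 2) t).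
  { apply Hd; change (Rabs (t' - t) < d); lra. }
  apply Rabs_def2 in Ht'; apply Rabs_def2 in Hs'.
  split; cbn; lra. }
assert (Hint : forall x, eps / 2 <= x <= s t - eps / 2 -> liquid_open s (x, t))
  by exact (locally_singleton t _ Hopen).
assert (Hex : locally t (fun t' => forall a b,
          eps / 2 <= a <= s t - eps / 2 -> eps / 2 <= b <= s t - eps / 2 ->
          ex_RInt (fun x => T x t' - Tm) a b)).
{ revert Hopen; apply filter_imp; intros t' Hopen a b Ha Hb.
  apply (ex_RInt_continuous (V := R_CompleteNormedModule)); intros x Hx.
  apply (continuous_minus (fun x => T x t') (fun _ => Tm)).
  - apply continuous_liquid_open_x; [exact temp_cont_open |].
    apply Hopen; revert Hx; unfold Rmin, Rmax.
    destruct (Rle_dec a b); lra.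
  - apply continuous_const. }
assert (Hdc : forall x v, liquid_open s (x, v) ->
   continuity_2d_pt (fun u v : R => Derive (fun z : R => T v z - Tm) u) v x).
{ intros x v Hx.
  apply (continuity_2d_pt_ext_loc (fun v u => Tt u v)).
  - refine (locally_2d_impl _ _ _ _ _ (liquid_open_locally x v Hx)).
    apply locally_2d_forall; intros t' x' H.
    symmetry; apply is_derive_unique, is_derive_temp_sub; exact H.
  - apply continuity_2d_liquid_open; [| exact Hx].
    exact (temp_dt_cont _ _ _ _ _ _ _ _ _ _ _ _ _ S). }
assert (Hdc2 : forall x, liquid_open s (x, t) -> locally_2d (fun v u =>
   continuity_2d_pt (fun u v : R => Derive (fun z : R => T v z - Tm) u) v u) t x).
{ intros x Hx.
  refine (locally_2d_impl _ _ _ _ _ (liquid_open_locally x t Hx)).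
  apply locally_2d_forall; intros t' x' H; apply Hdc; exact H. }
assert (Hcx : forall x, liquid_open s (x, t) ->
   continuity_pt (fun x => T x t - Tm) x).
{ intros x Hx; apply continuity_pt_filterlim.
  apply (continuous_minus (fun x => T x t) (fun _ => Tm)).
  - apply continuous_liquid_open_x; [exact temp_cont_open | exact Hx].
  - apply continuous_const. }
assert (He4 : 0 < eps / 4) by lra.
assert (HI : RInt (fun x => Derive (fun tau => T x tau - Tm) t) eps (s t - eps)
   = alpha * (Tx (s t - eps) t - Tx eps t)).
{ rewrite (RInt_ext _ (fun x => scal alpha (Txx x t))).
  - apply is_RInt_unique.
    apply (is_RInt_scal (V := R_NormedModule)).
    apply (is_RInt_derive (V := R_CompleteNormedModule) (fun x => Tx x t));
      rewrite Rmin_left, Rmax_right by lra; intros x Hx.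
    + apply (temp_dxx _ _ _ _ _ _ _ _ _ _ _ _ _ S), Hint; lra.
    + apply continuous_liquid_open_x;
        [exact (temp_dxx_cont _ _ _ _ _ _ _ _ _ _ _ _ _ S) | apply Hint; lra].
  - rewrite Rmin_left, Rmax_right by lra; intros x Hx.
    assert (Hl : liquid_open s (x, t)) by (apply Hint; lra).
    transitivity (Tt x t); [exact (is_derive_unique _ _ _ (is_derive_temp_sub x t Hl)) |].
    exact (heat_equation _ _ _ _ _ _ _ _ _ _ _ _ _ S x t Hl). }
rewrite <- HI.
(* The zero term is the contribution of the fixed lower endpoint [eps], in the shape of the Leibniz
   rule. *)
replace (RInt _ _ _ + _) with
  (RInt (fun x => Derive (fun tau => T x tau - Tm) t) eps (s t - eps)
   + - (T eps t - Tm) * 0 + (T (s t - eps) t - Tm) * (- beta * Tx (s t) t)) by ring.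
apply (is_derive_RInt_param_bound_comp (fun tau x => T x tau - Tm)
         (fun _ => eps) (fun tau => s tau - eps)).
- revert Hex; apply filter_imp; intros t' Hex; apply Hex; lra.
- exists (mkposreal _ He4); revert Hex; apply filter_imp; intros t' Hex; simpl; apply Hex; lra.
- exists (mkposreal _ He4); revert Hex; apply filter_imp; intros t' Hex; simpl; apply Hex; lra.
- apply (is_derive_const (V := R_NormedModule)).
- replace (- beta * Tx (s t) t) with (minus (- beta * Tx (s t) t) 0) by apply Rminus_0_r.
  apply (is_derive_minus s (fun _ => eps)).
  + exact (interface_motion _ _ _ _ _ _ _ _ _ _ _ _ _ S t Ht).
  + apply (is_derive_const (V := R_NormedModule)).
- exists (mkposreal _ He4); revert Hopen; apply filter_imp; intros t' Hopen x; simpl.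
  rewrite Rmin_left, Rmax_right by lra; intros Hx.
  exists (Tt x t'); apply is_derive_temp_sub, Hopen; lra.
- intros x; rewrite Rmin_left, Rmax_right by lra; intros Hx.
  apply Hdc, Hint; lra.
- apply Hdc2, Hint; lra.
- apply Hdc2, Hint; lra.
- apply Hcx, Hint; lra.
- apply Hcx, Hint; lra.
Qed.

(** * Rescaling to a fixed interval and continuity of the energy error *)

(* The clamps extend the temperature, in the coordinate [y = x / s t], to a
   function continuous on the whole plane. *)
Definition rescaled_temp (y t : R) : R :=
  T (s (Rmax 0 t) * Rmax 0 (Rmin 1 y)) (Rmax 0 t) - Tm.

Lemma interface_continuous_ext (t : R) : continuous (fun t => s (Rmax 0 t)) t.
Proof.
apply (continuous_on_comp (fun t => 0 <= t) s).
- exact (interface_cont _ _ _ _ _ _ _ _ _ _ _ _ _ S).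
- intros y; apply Rmax_l.
- apply continuous_Rmax_l.
Qed.

Lemma rescaled_temp_continuous (y t : R) : continuity_2d_pt rescaled_temp y t.
Proof.
apply continuity_2d_pt_filterlim.
apply (continuous_comp (fun p : R * R =>
  T (s (Rmax 0 (snd p)) * Rmax 0 (Rmin 1 (fst p))) (Rmax 0 (snd p)))
  (fun z => z - Tm)).
2: { apply (continuous_minus (fun z : R => z) (fun _ => Tm)).
     apply continuous_id. apply continuous_const. }
apply (continuous_on_comp (liquid_closed s) (uncurry2 T) (fun p : R * R =>
  (s (Rmax 0 (snd p)) * Rmax 0 (Rmin 1 (fst p)), Rmax 0 (snd p)))).
- exact (temp_cont _ _ _ _ _ _ _ _ _ _ _ _ _ S).
- intros [u v]; assert (H0 := Rmax_l 0 v).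
  assert (Hs := interface_pos _ _ _ _ _ _ _ _ _ _ _ _ _ S _ H0).
  assert (Hm : 0 <= Rmax 0 (Rmin 1 u) <= 1).
  { split; [apply Rmax_l | apply Rmax_lub; [lra | apply Rmin_l]]. }
  split; cbn -[Rmax Rmin]; [exact H0 |]; split; nra.
- assert (Hsnd : continuous (fun p : R * R => Rmax 0 (snd p)) (y, t)).
  { apply (continuous_comp (fun p : R * R => snd p) (Rmax 0)).
    apply continuous_snd. apply continuous_Rmax_l. }
  apply (continuous_comp_2 (fun p : R * R => s (Rmax 0 (snd p)) * Rmax 0 (Rmin 1 (fst p)))
    (fun p : R * R => Rmax 0 (snd p)) (fun a b => (a, b))).
  + apply (continuous_mult (fun p : R * R => s (Rmax 0 (snd p)))).
    * apply (continuous_comp (fun p : R * R => snd p) (fun t => s (Rmax 0 t))).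
      apply continuous_snd. apply interface_continuous_ext.
    * apply (continuous_comp (fun p : R * R => Rmin 1 (fst p)) (Rmax 0)).
      -- apply (continuous_comp (fun p : R * R => fst p) (Rmin 1)).
         apply continuous_fst. apply continuous_Rmin_l.
      -- apply continuous_Rmax_l.
  + exact Hsnd.
  + apply continuous_ext with (fun p : R * R => p); [intros [a b]; reflexivity | apply continuous_id].
Qed.

Lemma rescaled_temp_spec (x t : R) :
  0 <= t -> 0 <= x <= s t -> rescaled_temp (x / s t) t = T x t - Tm.
Proof.
intros Ht Hx.
assert (Hs := interface_pos _ _ _ _ _ _ _ _ _ _ _ _ _ S _ Ht).
assert (0 <= x / s t <= 1).
{ split.
  - apply Rdiv_le_0_compat; lra.
  - apply (Rmult_le_reg_r (s t)); [exact Hs |].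
    unfold Rdiv; rewrite Rmult_assoc, Rinv_l; lra. }
unfold rescaled_temp; rewrite (Rmax_right 0 t) by exact Ht.
rewrite (Rmin_right 1), (Rmax_right 0) by lra.
replace (s t * (x / s t)) with x by (field; lra); reflexivity.
Qed.

Lemma ex_RInt_rescaled_temp (t a b : R) :
  ex_RInt (fun x => rescaled_temp (x / s t) t) a b.
Proof.
apply (ex_RInt_continuous (V := R_CompleteNormedModule)); intros x _.
apply (continuous_comp_2 (fun x : R => x / s t) (fun _ : R => t) rescaled_temp).
- apply (continuous_mult (fun x : R => x)); [apply continuous_id | apply continuous_const].
- apply continuous_const.
- apply continuity_2d_pt_filterlim, rescaled_temp_continuous.
Qed.

(** The substitution [x = s t * y] trades the moving domain for [[0, 1]], where
    [continuous_RInt_param] applies. *)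
Lemma RInt_temp (t : R) : 0 <= t ->
  RInt (fun x => T x t - Tm) 0 (s t) = s t * RInt (fun y => rescaled_temp y t) 0 1.
Proof.
intros Ht.
assert (Hs := interface_pos _ _ _ _ _ _ _ _ _ _ _ _ _ S _ Ht).
transitivity (RInt (fun x => rescaled_temp (x / s t) t) 0 (s t)).
{ apply RInt_ext; rewrite Rmin_left, Rmax_right by lra; intros x Hx.
  symmetry; apply rescaled_temp_spec; lra. }
transitivity (RInt (fun x => rescaled_temp (x / s t) t) (s t * 0 + 0) (s t * 1 + 0)).
{ f_equal; ring. }
rewrite <- (RInt_comp_lin (V := R_CompleteNormedModule)) by apply ex_RInt_rescaled_temp.
rewrite <- (RInt_scal (V := R_CompleteNormedModule) (fun y => rescaled_temp y t)).
- apply RInt_ext; intros y _; do 2 f_equal; field; lra.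
- apply (ex_RInt_continuous (V := R_CompleteNormedModule)); intros x _.
  apply (continuous_comp_2 (fun x : R => x) (fun _ : R => t) rescaled_temp).
  + apply continuous_id.
  + apply continuous_const.
  + apply continuity_2d_pt_filterlim, rescaled_temp_continuous.
Qed.

(** The clamp [Rmax 0 t] turns one-sided continuity at time 0 into two-sided continuity, so that
    time 0 needs no separate treatment. *)
Lemma energy_error_continuous (sr t : R) :
  continuous (fun t => energy_error k alpha beta Tm sr T s (Rmax 0 t)) t.
Proof.
unfold energy_error.
apply (continuous_plus (fun t => k / alpha * RInt (fun x => T x (Rmax 0 t) - Tm) 0 (s (Rmax 0 t)))
  (fun t => k / beta * (s (Rmax 0 t) - sr))).
- apply (continuous_scal_r (k / alpha)
    (fun t => RInt (fun x => T x (Rmax 0 t) - Tm) 0 (s (Rmax 0 t)))).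
  apply continuous_ext with
    (fun t => s (Rmax 0 t) * RInt (fun y => rescaled_temp y t) 0 1).
  + intros u; rewrite RInt_temp by apply Rmax_l.
    f_equal; apply RInt_ext; intros y _; unfold rescaled_temp.
    rewrite (Rmax_right 0 (Rmax 0 u)) by apply Rmax_l; reflexivity.
  + apply (continuous_mult (fun t => s (Rmax 0 t))).
    * apply interface_continuous_ext.
    * apply continuous_RInt_param; [lra | exact rescaled_temp_continuous].
- apply (continuous_scal_r (k / beta) (fun t => s (Rmax 0 t) - sr)).
  apply (continuous_minus (fun t => s (Rmax 0 t)) (fun _ => sr)).
  + apply interface_continuous_ext.
  + apply continuous_const.
Qed.

(** * The limit [eps -> 0] and the heat balance *)

Lemma truncated_energy_lim (t : R) (zeta : posreal) : 0 <= t ->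
  at_right 0 (fun eps => Rabs (RInt (fun x => T x t - Tm) eps (s t - eps)
                               - RInt (fun x => T x t - Tm) 0 (s t)) < zeta).
Proof.
intros Ht.
assert (Hs := interface_pos _ _ _ _ _ _ _ _ _ _ _ _ _ S _ Ht).
(* [g] agrees with [T - Tm] on the liquid segment and is continuous on the whole line, so its
   integral depends continuously on both endpoints. *)
set (g := fun x => rescaled_temp (x / s t) t).
assert (Hg : forall eps, 0 <= eps -> 2 * eps <= s t ->
  RInt (fun x => T x t - Tm) eps (s t - eps) = RInt g eps (s t - eps)).
{ intros eps He Hes; apply RInt_ext; rewrite Rmin_left, Rmax_right by lra.
  intros x Hx; symmetry; apply rescaled_temp_spec; lra. }
assert (Hc : continuous (fun eps => RInt g eps (s t - eps)) 0).
{ apply (continuous_comp_2 (fun eps : R => eps) (fun eps : R => s t - eps) (fun a b => RInt g a b)).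
  - apply continuous_id.
  - apply (continuous_minus (fun _ : R => s t) (fun eps : R => eps)).
    apply continuous_const. apply continuous_id.
  - apply (continuous_RInt (V := R_NormedModule) g).
    apply filter_forall; intros p.
    apply (RInt_correct (V := R_CompleteNormedModule)), ex_RInt_rescaled_temp. }
destruct (proj1 (continuity_pt_locally _ _)
  (proj2 (continuity_pt_filterlim _ _) Hc) zeta) as [d Hd].
assert (Hm : 0 < Rmin d (s t / 2)) by (apply Rmin_glb_lt; [apply cond_pos | lra]).
exists (mkposreal _ Hm); intros eps Hball Heps.
change (Rabs (eps - 0) < Rmin d (s t / 2)) in Hball.
assert (H1 := Rmin_l d (s t / 2)); assert (H2 := Rmin_r d (s t / 2)).
specialize (Hd eps).
assert (Hb : Rabs (eps - 0) < d) by lra.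
apply Hd in Hb; apply Rabs_def2 in Hball.
replace (RInt (fun x => T x t - Tm) 0 (s t)) with (RInt g 0 (s t - 0)).
- rewrite Hg by lra; exact Hb.
- rewrite <- Hg by lra; rewrite Rminus_0_r; reflexivity.
Qed.

(** Formally, the flux [k * Tx (s t) t] cancels against [k / beta] times the interface velocity, the
    moving endpoint contributes nothing as [T = Tm] there, and [- k * Tx 0 t = q (t - D)]
    remains. *)
Lemma energy_error_derive (sr t : R) :
  0 < k -> 0 < alpha -> 0 < beta -> 0 < t -> continuous q (t - D) ->
  is_derive (energy_error k alpha beta Tm sr T s) t (q (t - D)).
Proof.
intros Hk Ha Hb Ht Hq.
assert (Hpos := interface_pos _ _ _ _ _ _ _ _ _ _ _ _ _ S).
assert (Hst : 0 < s t) by (apply Hpos; lra).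
(* [eta * M] will bound the moving-endpoint term, the [+ 1] absorbing a deviation of the flux by
   [eta <= 1]; three flux deviations add [3 * k * eta]. *)
set (M := k / alpha * beta * (Rabs (Tx (s t) t) + 1)).
assert (Hka : 0 < k / alpha) by (apply Rdiv_lt_0_compat; assumption).
assert (Hkb : 0 < k / alpha * beta) by (apply Rmult_lt_0_compat; assumption).
assert (HM : 0 < M).
{ apply Rmult_lt_0_compat; [exact Hkb |]. generalize (Rabs_pos (Tx (s t) t)); lra. }
apply is_derive_Reals; intros e He.
assert (He2 : 0 < Rmin 1 (e / 2 / (3 * k + M))).
{ apply Rmin_glb_lt; [lra | apply Rdiv_lt_0_compat; lra]. }
set (eta := mkposreal _ He2).
assert (Heta1 : eta <= 1) by apply Rmin_l.
assert (Heta2 : eta * (3 * k + M) <= e / 2).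
{ apply Rle_trans with (e / 2 / (3 * k + M) * (3 * k + M)).
  - apply Rmult_le_compat_r; [lra | apply Rmin_r].
  - right; field; lra. }
assert (Heta0 := cond_pos eta).
destruct (continuous_on_near (flux_domain D s q) Tx (s t) t eta) as [d1 Hd1].
{ exact (temp_dx_cont _ _ _ _ _ _ _ _ _ _ _ _ _ S). }
{ repeat split; cbn; try lra. }
(* Continuity of [q] at [t - D] is what puts [(0, t)] into [flux_domain]. *)
destruct (continuous_on_near (flux_domain D s q) Tx 0 t eta) as [d2 Hd2].
{ exact (temp_dx_cont _ _ _ _ _ _ _ _ _ _ _ _ _ S). }
{ repeat split; cbn; try lra. intros _; exact Hq. }
destruct (continuous_on_near (liquid_closed s) T (s t) t eta) as [d3 Hd3].
{ exact (temp_cont _ _ _ _ _ _ _ _ _ _ _ _ _ S). }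
{ repeat split; cbn; lra. }
rewrite (melting_temp _ _ _ _ _ _ _ _ _ _ _ _ _ S t Ht) in Hd3.
set (r := Rmin (Rmin d1 d2) (Rmin d3 (s t))).
assert (Hr : 0 < r).
{ repeat apply Rmin_glb_lt; try apply cond_pos; exact Hst. }
assert (Hrd1 : r <= d1) by (eapply Rle_trans; [apply Rmin_l | apply Rmin_l]).
assert (Hrd2 : r <= d2) by (eapply Rle_trans; [apply Rmin_l | apply Rmin_r]).
assert (Hrd3 : r <= d3) by (eapply Rle_trans; [apply Rmin_r | apply Rmin_l]).
assert (Hrs : r <= s t) by (eapply Rle_trans; [apply Rmin_r | apply Rmin_r]).
(* With [eps] and the interface displacement both below [r / 4], the point [s tau - eps] is within
   [r / 2] of [s t], and [2 * eps < s tau] because [r <= s t]. *)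
assert (Hr4 : 0 < r / 4) by lra.
destruct (proj1 (continuity_pt_locally s t)
  (proj2 (continuity_pt_filterlim s t) (interface_continuous t Ht))
  (mkposreal _ Hr4)) as [d4 Hd4].
assert (Hdel : 0 < Rmin (Rmin r d4) t).
{ repeat apply Rmin_glb_lt; try apply cond_pos; assumption. }
set (del := mkposreal _ Hdel).
assert (Hdr : del <= r) by (eapply Rle_trans; [apply Rmin_l | apply Rmin_l]).
assert (Hdd4 : del <= d4) by (eapply Rle_trans; [apply Rmin_l | apply Rmin_r]).
assert (Hdt : del <= t) by apply Rmin_r.
clearbody del r eta.
exists del; intros h Hh0 Hh.
set (F := fun eps tau => k / alpha * RInt (fun x => T x tau - Tm) eps (s tau - eps)
                         + k / beta * (s tau - sr)).
set (dF := fun eps tau => k / alpha * (alpha * (Tx (s tau - eps) tau - Tx eps tau)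
     + (T (s tau - eps) tau - Tm) * (- beta * Tx (s tau) tau))
     + k / beta * (- beta * Tx (s tau) tau)).
(* The bound [e / 2] is uniform in [eps] and [tau], hence survives the limit [eps -> 0]. *)
assert (HF : forall eps tau, 0 < eps < r / 4 -> Rabs (tau - t) < del ->
   is_derive (F eps) tau (dF eps tau) /\ Rabs (dF eps tau - q (t - D)) <= e / 2).
{ intros eps tau Heps Htau.
  assert (Hs4 : Rabs (s tau - s t) < r / 4).
  { apply Hd4; change (Rabs (tau - t) < d4); lra. }
  assert (Htau' := Rabs_def2 _ _ Htau).
  assert (Hs4' := Rabs_def2 _ _ Hs4).
  split.
  - apply (is_derive_plus
      (fun tau => k / alpha * RInt (fun x => T x tau - Tm) eps (s tau - eps))
      (fun tau => k / beta * (s tau - sr))).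
    + apply (is_derive_scal
        (fun tau => RInt (fun x => T x tau - Tm) eps (s tau - eps))).
      apply truncated_energy_derive; lra.
    + apply (is_derive_scal (fun tau => s tau - sr)).
      replace (- beta * Tx (s tau) tau) with (minus (- beta * Tx (s tau) tau) 0)
        by apply Rminus_0_r.
      apply (is_derive_minus s (fun _ => sr)).
      * apply (interface_motion _ _ _ _ _ _ _ _ _ _ _ _ _ S); lra.
      * apply (is_derive_const (V := R_NormedModule)).
  - assert (B1 : Rabs (Tx (s tau - eps) tau - Tx (s t) t) < eta).
    { apply Hd1; [repeat split; cbn; lra | apply Rabs_def1; lra | lra]. }
    assert (B2 : Rabs (Tx (s tau) tau - Tx (s t) t) < eta).
    { apply Hd1; [repeat split; cbn; lra | lra | lra]. }
    assert (B3 : Rabs (Tx eps tau - Tx 0 t) < eta).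
    { apply Hd2; [repeat split; cbn; lra | apply Rabs_def1; lra | lra]. }
    assert (B4 : Rabs (T (s tau - eps) tau - Tm) < eta).
    { apply Hd3; [repeat split; cbn; lra | apply Rabs_def1; lra | lra]. }
    rewrite <- (boundary_flux _ _ _ _ _ _ _ _ _ _ _ _ _ S t Ht Hq).
    set (u1 := Tx (s tau - eps) tau - Tx (s t) t) in *.
    set (u2 := Tx (s tau) tau - Tx (s t) t) in *.
    set (u3 := Tx eps tau - Tx 0 t) in *.
    set (u4 := T (s tau - eps) tau - Tm) in *.
    (* The reference flux [Tx (s t) t] cancels outside the product with [u4]; every remaining term
       contains a small deviation. *)
    replace (dF eps tau - - k * Tx 0 t)
      with (k * u1 + - (k * u2) + - (k * u3) + - (k / alpha * beta * (u4 * (u2 + Tx (s t) t))))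
      by (unfold dF, u1, u2, u3, u4; field; lra).
    assert (P : Rabs (u4 * (u2 + Tx (s t) t)) <= eta * (Rabs (Tx (s t) t) + 1)).
    { rewrite Rabs_mult; apply Rmult_le_compat; try apply Rabs_pos; [lra |].
      generalize (Rabs_triang u2 (Tx (s t) t)); lra. }
    assert (P1 : k * Rabs u1 <= k * eta) by (apply Rmult_le_compat_l; lra).
    assert (P2 : k * Rabs u2 <= k * eta) by (apply Rmult_le_compat_l; lra).
    assert (P3 : k * Rabs u3 <= k * eta) by (apply Rmult_le_compat_l; lra).
    assert (P4 := Rmult_le_compat_l (k / alpha * beta) _ _ (Rlt_le _ _ Hkb) P).
    eapply Rle_trans; [apply Rabs_triang |].
    eapply Rle_trans; [apply Rplus_le_compat_r, Rabs_triang |].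
    eapply Rle_trans; [apply Rplus_le_compat_r, Rplus_le_compat_r, Rabs_triang |].
    rewrite !Rabs_Ropp, !(Rabs_mult k), (Rabs_mult (k / alpha * beta)).
    rewrite (Rabs_pos_eq k), (Rabs_pos_eq (k / alpha * beta)) by lra.
    replace (eta * (3 * k + M)) with (k * eta + k * eta + k * eta
      + k / alpha * beta * (eta * (Rabs (Tx (s t) t) + 1))) in Heta2
      by (unfold M; ring).
    lra. }
assert (HMVT : forall eps, 0 < eps < r / 4 ->
   Rabs (F eps (t + h) - F eps t - q (t - D) * h) <= e / 2 * Rabs h).
{ intros eps Heps.
  assert (Hin : forall tau, Rmin t (t + h) <= tau <= Rmax t (t + h) ->
             Rabs (tau - t) < del).
  { apply Rabs_def2 in Hh; intros tau; unfold Rmin, Rmax.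
    destruct (Rle_dec t (t + h)); intros Htau; apply Rabs_def1; lra. }
  destruct (MVT_gen (F eps) t (t + h) (dF eps)) as [xi [Hxi HE]].
  - intros tau Htau; apply HF; [exact Heps | apply Hin; lra].
  - intros tau Htau; apply continuity_pt_filterlim.
    apply (ex_derive_continuous (F eps)); exists (dF eps tau).
    apply HF; [exact Heps | apply Hin; lra].
  - rewrite HE.
    replace (dF eps xi * (t + h - t) - q (t - D) * h)
      with ((dF eps xi - q (t - D)) * h) by ring.
    rewrite Rabs_mult; apply Rmult_le_compat_r; [apply Rabs_pos |].
    apply HF; [exact Heps | apply Hin, Hxi]. }
set (E := energy_error k alpha beta Tm sr T s).
assert (HE : Rabs (E (t + h) - E t - q (t - D) * h) <= e / 2 * Rabs h).
(* The truncation errors at [t] and [t + h], weighted by [k / alpha], cost at most [z / 2] each. *)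
{ apply le_epsilon; intros z Hz.
  assert (Hz' : 0 < z / (2 * (k / alpha))) by (apply Rdiv_lt_0_compat; lra).
  assert (Hh' := Rabs_def2 _ _ Hh).
  assert (Hth : 0 <= t + h) by lra.
  assert (Hnear : at_right 0 (fun eps => 0 < eps < r / 4)).
  { exists (mkposreal _ Hr4); intros eps Hball Heps.
    change (Rabs (eps - 0) < r / 4) in Hball.
    apply Rabs_def2 in Hball; lra. }
  destruct (filter_ex (F := at_right 0) _ (filter_and _ _ Hnear
    (filter_and _ _ (truncated_energy_lim t (mkposreal _ Hz') (Rlt_le _ _ Ht))
      (truncated_energy_lim (t + h) (mkposreal _ Hz') Hth))))
    as [eps [L1 [L2 L3]]]; simpl in L2, L3.
  specialize (HMVT eps L1).
  set (j1 := RInt (fun x => T x t - Tm) eps (s t - eps)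
             - RInt (fun x => T x t - Tm) 0 (s t)) in *.
  set (j2 := RInt (fun x => T x (t + h) - Tm) eps (s (t + h) - eps)
             - RInt (fun x => T x (t + h) - Tm) 0 (s (t + h))) in *.
  replace (E (t + h) - E t - q (t - D) * h)
    with ((F eps (t + h) - F eps t - q (t - D) * h) + k / alpha * (j1 - j2))
    by (unfold E, energy_error, F, j1, j2; ring).
  eapply Rle_trans; [apply Rabs_triang |].
  apply Rplus_le_compat; [exact HMVT |].
  rewrite Rabs_mult, (Rabs_pos_eq (k / alpha)) by lra.
  apply Rle_trans with (k / alpha * (2 * (z / (2 * (k / alpha))))).
  - apply Rmult_le_compat_l; [lra |].
    apply Rabs_def2 in L2; apply Rabs_def2 in L3; left; apply Rabs_def1; lra.
  - right; field; split; lra. }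
assert (Hh1 := Rabs_pos_lt h Hh0).
replace ((E (t + h) - E t) / h - q (t - D))
  with ((E (t + h) - E t - q (t - D) * h) * / h) by (field; exact Hh0).
rewrite Rabs_mult, Rabs_inv.
apply Rle_lt_trans with (e / 2 * Rabs h * / Rabs h).
- apply Rmult_le_compat_r; [left; apply Rinv_0_lt_compat, Hh1 | exact HE].
- rewrite Rmult_assoc, Rinv_r; lra.
Qed.

End Plant.

(** * Comparison of the energy error at [t] and [t + D] *)

Theorem mainTheorem3
  (rho Cp k dH : R) (hrho : 0 < rho) (hCp : 0 < Cp) (hk : 0 < k) (hdH : 0 < dH)
  (alpha beta : R) (halpha : alpha = k / (rho * Cp)) (hbeta : beta = k / (rho * dH))
  (Tm D c : R) (hD : 0 < D) (hc : 0 < c)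
  (T0 : R -> R) (s0 sr : R) (q : R -> R)
  (hpc : piecewise_continuous q (- D) 0)
  (A1 : initial_data_assumption Tm T0 s0)
  (A2 : past_input_assumption D q)
  (A3 : setpoint_assumption k alpha beta Tm D T0 s0 q sr)
  (T Tx Txx Tt : R -> R -> R) (s : R -> R)
  (hsol : closed_loop_solution c k alpha beta Tm D sr T0 s0 T Tx Txx Tt s q) :
  forall t : R, 0 <= t ->
    q t = nominal_control c k alpha beta Tm sr T s (t + D).
Proof.
intros t Ht.
destruct hsol as [S Hint Hfb].
assert (ha : 0 < alpha).
{ rewrite halpha; apply Rdiv_lt_0_compat; [exact hk | apply Rmult_lt_0_compat; assumption]. }
assert (hb : 0 < beta).
{ rewrite hbeta; apply Rdiv_lt_0_compat; [exact hk | apply Rmult_lt_0_compat; assumption]. }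
set (E := energy_error k alpha beta Tm sr T s).
(* The hypotheses do not determine [q] before [- D]; [qe] is integrable on every
   interval. *)
set (qe := fun u => if Rlt_dec u (- D) then 0 else q u).
assert (Hqe : forall a b, - D <= a -> a <= b -> RInt qe a b = RInt q a b).
{ intros a b Ha Hab; apply RInt_ext; rewrite Rmin_left, Rmax_right by lra.
  intros u Hu; unfold qe; destruct (Rlt_dec u (- D)); lra. }
assert (Hint0 : forall b, ex_RInt qe (- D) b).
{ intros b; destruct (Rle_lt_dec (- D) b) as [H|H].
  - apply (ex_RInt_Chasles_1 (V := R_CompleteNormedModule)) with (Rmax 0 b).
    + split; [exact H | apply Rmax_r].
    + apply ex_RInt_ext with q.
      * rewrite Rmin_left by (apply Rle_trans with b; [exact H | apply Rmax_r]).
        intros u Hu; unfold qe; destruct (Rlt_dec u (- D)); lra.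
      * apply Hint, Rmax_l.
  - apply ex_RInt_ext with (fun _ => 0).
    + rewrite Rmax_left by lra.
      intros u Hu; unfold qe; destruct (Rlt_dec u (- D)); lra.
    + apply ex_RInt_const. }
set (Q := fun b => RInt qe (- D) b).
(* Window integrals of the input become differences of one continuous primitive [Q]. *)
assert (HQ : forall a b, - D <= a -> a <= b -> RInt q a b = Q b - Q a).
{ intros a b Ha Hab; rewrite <- Hqe by assumption.
  assert (H : Q a + RInt qe a b = Q b); [| lra].
  apply (RInt_Chasles (V := R_CompleteNormedModule)); [apply Hint0 |].
  apply (ex_RInt_Chasles (V := R_CompleteNormedModule)) with (- D);
    [apply ex_RInt_swap |]; apply Hint0. }
assert (HQc : forall b, continuous Q b).
{ intros b; apply (continuous_RInt_1 (V := R_NormedModule) qe (- D) b Q).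
  apply filter_forall; intros z.
  apply (RInt_correct (V := R_CompleteNormedModule)), Hint0. }
assert (HQd : forall u, - D < u -> continuous q u -> is_derive Q u (q u)).
{ intros u Hu Hq.
  assert (Hloc : locally u (fun v => q v = qe v)).
  { apply (filter_imp (fun v => - D < v)).
    - intros v Hv; unfold qe; destruct (Rlt_dec v (- D)); lra.
    - apply (open_gt (- D)), Hu. }
  replace (q u) with (qe u) by (symmetry; exact (locally_singleton u _ Hloc)).
  apply (is_derive_RInt (V := R_NormedModule) qe Q (- D)).
  - apply filter_forall; intros z.
    apply (RInt_correct (V := R_CompleteNormedModule)), Hint0.
  - apply continuous_ext_loc with q; assumption. }
(* The feedback law expresses [q] through [Q] and the energy error, both continuous. At 0 it governs
   only one side, so [q] may jump there. *)
assert (Hqc : forall u, 0 < u -> continuous q u).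
{ intros u Hu.
  apply continuous_ext_loc with
    (fun v => - c * (Q v - Q (v - D) + E (Rmax 0 v))).
  - apply (filter_imp (fun v => 0 < v)); [| apply (open_gt 0), Hu].
    intros v Hv; rewrite (Hfb v) by lra; unfold delay_compensated_control.
    rewrite HQ, Rmax_right by lra; reflexivity.
  - apply (continuous_scal_r (- c) (fun v => Q v - Q (v - D) + E (Rmax 0 v))).
    apply (continuous_plus (fun v => Q v - Q (v - D)) (fun v => E (Rmax 0 v))).
    + apply (continuous_minus Q (fun v => Q (v - D))); [apply HQc |].
      apply (continuous_comp (fun v => v - D) Q); [| apply HQc].
      apply (continuous_minus (fun v : R => v) (fun _ => D)).
      apply continuous_id. apply continuous_const.
    + apply (energy_error_continuous S). }
destruct hpc as [jumps Hj].
set (G := fun v => E (Rmax 0 v) - Q (v - D)).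
assert (HG : G (t + D) = G t).
(* Exceptional times are the jumps of the past input delayed by [D], and [D] itself, when the
   switching-on of the feedback reaches the boundary. *)
{ apply (derive_zero_off_finite_eq (D :: map (fun u => u + D) jumps)); [lra | |].
  - intros v _.
    apply (continuous_minus (fun v => E (Rmax 0 v)) (fun v => Q (v - D))).
    + apply (energy_error_continuous S).
    + apply (continuous_comp (fun v => v - D) Q); [| apply HQc].
      apply (continuous_minus (fun v : R => v) (fun _ => D)).
      apply continuous_id. apply continuous_const.
  - intros v Hv Hn.
    assert (Hqv : continuous q (v - D)).
    (* Before time [D] the boundary receives the past input, after it the feedback. *)
    { destruct (Rtotal_order v D) as [H|[H|H]].
      - apply Hj; [lra |].
        intros Hin; apply Hn; right.
        apply in_map_iff; exists (v - D); split; [ring | exact Hin].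
      - elim Hn; left; symmetry; exact H.
      - apply Hqc; lra. }
    replace 0 with (minus (q (v - D)) (scal 1 (q (v - D))))
      by (unfold minus, plus, opp, scal; simpl; unfold mult; simpl; ring).
    apply (is_derive_minus (fun v => E (Rmax 0 v)) (fun v => Q (v - D))).
    + apply is_derive_ext_loc with E.
      * apply (filter_imp (fun w => 0 < w)); [| apply (open_gt 0); lra].
        intros w Hw; rewrite Rmax_right by lra; reflexivity.
      * apply (energy_error_derive S); try assumption; lra.
    + apply (is_derive_comp Q (fun v => v - D)).
      * apply HQd; [lra | exact Hqv].
      * auto_derive; [exact I | ring]. }
(* The equality reads [E (t + D) = E t + (Q t - Q (t - D))], whose right side is the bracket of the
   feedback law. *)
unfold G in HG; rewrite !Rmax_right in HG by lra.
replace (t + D - D) with t in HG by ring.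
rewrite (Hfb t Ht); unfold delay_compensated_control, nominal_control.
fold E; rewrite HQ by lra; f_equal; lra.
Qed.
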